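(* Let $m\ge 1$, let $L = J(P)\subseteq 2^{[m]}$ be a natural distributive lattice (with $P$ the corresponding poset on $[m]$), and let $G=([m],E)$ be a simple undirected graph. If $p\in\mathbb{R}^{2^{[m]}}$ is a probability distribution of $m$ binary random variables with $\operatorname{supp}(p)=L$ and $p$ satisfies the pairwise Markov statements of $G$, then $p$ factors according to $G$.
   Context: Notation: $[m]=\{1,\dots,m\}$. A joint distribution of binary random variables $X_1,\dots,X_m$ is a vector $p=(p_S)_{S\subseteq[m]}$ of nonnegative reals summing to $1$, where $p_S$ is the probability that $\{j: X_j=1\}=S$. Its support is $\operatorname{supp}(p)=\{S\subseteq[m]: p_S>0\}$. Natural lattices: $L\subseteq 2^{[m]}$ is a distributive lattice if it is closed under $\cap$ and $\cup$. It is natural if $\emptyset\in L$, $[m]\in L$, and the rank of every $S\in L$ (the length of a maximal chain in $L$ from the minimum of $L$ to $S$) equals the cardinality $\#S$. For a poset $P=([m],\le)$, $J(P)$ is the set of order ideals of $P$ (subsets $S\subseteq[m]$ such that $t\in S$, $s\le t$ imply $s\in S$). Every natural lattice $L\subseteq 2^{[m]}$ is of the form $L=J(P)$ for a poset $P$ on $[m]$. Pairwise Markov statements: $p$ satisfies the pairwise Markov statements of $G$ if $X_i\perp\!\!\!\perp X_j\mid X_{[m]\setminus\{i,j\}}$ for every pair $i\neq j$ with $\{i,j\}\notin E$; equivalently, for every such pair and every $C\subseteq[m]\setminus\{i,j\}$, $p_C\,p_{C\cup\{i,j\}}=p_{C\cup\{i\}}\,p_{C\cup\{j\}}$. Factorization: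 let $\mathcal{C}(G)^{\max}$ be the set of maximal cliques of $G$. The distribution $p$ factors according to $G$ if there are real parameters $a^S_T$ (for $S\in\mathcal{C}(G)^{\max}$, $T\subseteq S$) and a normalizing constant $Z$ with $p_T=\frac1Z\prod_{S\in\mathcal{C}(G)^{\max}}a^S_{S\cap T}$ for all $T\subseteq[m]$. *)

(* Defs.v *)
From mathcomp Require Import all_boot all_order all_algebra.
From mathcomp Require Import reals.

Set Implicit Arguments.
Unset Strict Implicit.
Unset Printing Implicit Defensive.

Import Order.TTheory GRing.Theory Num.Theory.

Local Open Scope ring_scope.

(* The index set [m] is the ordinal type 'I_m; a subset S of [m] encodes the  *)
(* joint outcome X_j = 1 for j in S, X_j = 0 for j outside S.                 *)

Section Lattices.
Variable T : finType.
Implicit Types (L C D : {set {set T}}) (S X Y : {set T}) (le : rel T).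

Definition is_poset le : Prop :=
  [/\ reflexive le, antisymmetric le & transitive le].

Definition order_ideal le S : bool :=
  [forall t in S, forall s, le s t ==> (s \in S)].

Definition ideal_lattice le : {set {set T}} := [set S | order_ideal le S].

(* Distributivity is automatic for a lattice of sets. *)
Definition set_lattice L : Prop :=
  forall X Y, X \in L -> Y \in L -> X :&: Y \in L /\ X :|: Y \in L.

Definition is_chain C : bool :=
  [forall X in C, forall Y in C, (X \subset Y) || (Y \subset X)].

(* For S in L, a chain that is maximal among those of {X in L | X \subset S}  *)
(* necessarily contains S and the minimum of L.                               *)
Definition maximal_chain_to L S C : bool :=
  maxset (fun D => is_chain D && (D \subset [set X in L | X \subset S])) C.

(* The length of a chain is one less than its number of elements.             *)
Definition has_rank L S (r : nat) : Prop :=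
  forall C, maximal_chain_to L S C -> #|C| = r.+1.

Definition natural_lattice L : Prop :=
  [/\ set_lattice L, set0 \in L, [set: T] \in L
    & forall S, S \in L -> has_rank L S #|S|].

End Lattices.

Section Graphs.
Variable T : finType.
Implicit Types (e : rel T) (S : {set T}).

Definition simple_graph e : Prop := symmetric e /\ irreflexive e.

Definition clique e S : bool :=
  [forall x in S, forall y in S, (x != y) ==> e x y].

Definition maximal_clique e S : bool := maxset (clique e) S.

End Graphs.

Section BinaryDistributions.
Variables (R : realType) (T : finType).
Implicit Types (p : {set T} -> R) (e : rel T) (A B C U : {set T}).

Definition distribution p : Prop :=
  (forall U, 0 <= p U) /\ \sum_U p U = 1.

Definition supp p : {set {set T}} := [set U | 0 < p U].

(* P(X_A = u_A), where u is the 0/1 vector with u_j = 1 iff j is in U.        *)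
Definition marginal p A U : R :=
  \sum_(V : {set T} | V :&: A == U :&: A) p V.

(* X_A and X_B are independent given X_C: for every outcome u,                *)
(* P(u_A, u_B, u_C) P(u_C) = P(u_A, u_C) P(u_B, u_C); both sides vanish when  *)
(* P(u_C) = 0, so this is P(u_A, u_B | u_C) = P(u_A | u_C) P(u_B | u_C)       *)
(* whenever the conditional probabilities are defined.                        *)
Definition cond_indep p A B C : Prop :=
  forall U, marginal p (A :|: B :|: C) U * marginal p C U
          = marginal p (A :|: C) U * marginal p (B :|: C) U.

Definition pairwise_markov e p : Prop :=
  forall i j, i != j -> ~~ e i j ->
    cond_indep p [set i] [set j] (~: [set i; j]).

(* Only the values a S U with U a subset of S are used. Since Z != 0, Z is    *)
(* the sum of the products as soon as p sums to 1.                            *)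
Definition factors_according_to e p : Prop :=
  exists (a : {set T} -> {set T} -> R) (Z : R), Z != 0 /\
    forall U, p U = Z^-1 * \prod_(S | maximal_clique e S) a S (S :&: U).

End BinaryDistributions.

(* Main.v *)
Require Import Defs.
From mathcomp Require Import all_boot all_order all_algebra.
From mathcomp Require Import reals.
From mathcomp Require Import ring.

(** Multiplicative Moebius inversion on L = J(P) writes p U, for U in L, as the
    product of weights q I over the ideals I contained in U.  For such U the
    condition I \subset U only depends on U through the antichain max I, and the
    Markov statements force q I = 1 as soon as max I contains two nonadjacent
    vertices; so the weights are functions on cliques.  The zeros of p are also
    cut out by cliques: a covering pair i < j of P must be an edge of G, since
    otherwise the Markov statement at C = {s <= j} \ {i, j} would read
    (positive) = 0, and a set is an ideal iff it respects all covering pairs. *)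

Set Implicit Arguments.
Unset Strict Implicit.
Unset Printing Implicit Defensive.

Import Order.TTheory GRing.Theory Num.Theory.

Local Open Scope ring_scope.

(** * From conditional independence to the product relations among the [p U] *)

Section Marginals.
Variables (R : realType) (T : finType).
Implicit Types (p : {set T} -> R) (e : rel T) (A U : {set T}) (i j : T).

Lemma marginalT p U : marginal p [set: T] U = p U.
Proof. by rewrite /marginal (big_pred1 U) // => V; rewrite !setIT. Qed.

(** Forgetting the coordinate [j] sums over its two outcomes, $X_j = 1$ and $X_j = 0$. *)
Lemma marginalD1 p A U j : j \in A ->
  marginal p (A :\ j) U = marginal p A (j |: U) + marginal p A (U :\ j).
Proof.
move=> jA; rewrite /marginal (bigID (fun V : {set T} => j \in V)) /=.
congr (_ + _); apply: eq_bigl => V; apply/andP/eqP.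
- move=> [/eqP/setP VU jV]; apply/setP=> x; move: (VU x); rewrite !inE.
  by case: (eqVneq x j) => [->|] //=; rewrite jV jA.
- move/setP=> VU; split.
    apply/eqP/setP=> x; move: (VU x); rewrite !inE.
    by case: (eqVneq x j) => [->|] //=; rewrite !andbF.
  by move: (VU j); rewrite !inE eqxx jA /= andbT.
- move=> [/eqP/setP VU jV]; apply/setP=> x; move: (VU x); rewrite !inE.
  by case: (eqVneq x j) => [->|] //=; rewrite (negbTE jV).
move/setP=> VU; split.
  apply/eqP/setP=> x; move: (VU x); rewrite !inE.
  by case: (eqVneq x j) => [->|] //=; rewrite !andbF.
by move: (VU j); rewrite !inE eqxx jA /= andbT => ->.
Qed.

Lemma pairwise_markov_mul e p i j U :
    pairwise_markov e p -> i != j -> ~~ e i j -> i \in U -> j \in U ->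
  p U * p (U :\ i :\ j) = p (U :\ i) * p (U :\ j).
Proof.
move=> mk ij nij iU jU; have := mk i j ij nij U.
have -> : [set i] :|: [set j] :|: ~: [set i; j] = [set: T].
  by apply/setP=> x; rewrite !inE orbN.
have -> : [set i] :|: ~: [set i; j] = [set: T] :\ j.
  apply/setP=> x; rewrite !inE; case: (eqVneq x i) => [->|] /=.
    by rewrite ij.
  by rewrite andbT.
have -> : [set j] :|: ~: [set i; j] = [set: T] :\ i.
  apply/setP=> x; rewrite !inE; case: (eqVneq x j) => [->|] /=.
    by rewrite eq_sym ij.
  by rewrite orbF andbT.
have -> : ~: [set i; j] = [set: T] :\ j :\ i.
  by apply/setP=> x; rewrite !inE negb_or andbT.
have jUi : j \in U :\ i by rewrite !inE eq_sym ij.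
rewrite !marginalD1 ?inE ?ij // !marginalT.
have jUE : j |: U = U by apply/setUidPr; rewrite sub1set.
have iUE : i |: U = U by apply/setUidPr; rewrite sub1set.
have ijUE : j |: U :\ i = U :\ i by apply/setUidPr; rewrite sub1set.
rewrite !(jUE, iUE, ijUE).
(* After expansion of the marginals, independence reads $a(a+b+c+d) = (a+c)(a+b)$; subtracting
   $a(a+b+c)$ leaves $ad = bc$. *)
move: (p U) (p (U :\ i)) (p (U :\ j)) (p (U :\ i :\ j)) => a b c d E.
apply: (addrI (a * (a + b + c))).
by transitivity (a * (a + c + (b + d))); [|rewrite E]; ring.
Qed.

End Marginals.

(** * Order ideals, their maximal elements, and covering pairs *)

Section Ideals.
Variables (T : finType) (le : rel T).
Hypothesis le_poset : is_poset le.
Implicit Types (I J U : {set T}) (x y z i j : T).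

Let le_refl : reflexive le. Proof. by case: le_poset. Qed.
Let le_anti : antisymmetric le. Proof. by case: le_poset. Qed.
Let le_trans : transitive le. Proof. by case: le_poset. Qed.

Lemma order_idealP I :
  reflect (forall x y, y \in I -> le x y -> x \in I) (order_ideal le I).
Proof.
apply: (iffP forall_inP) => [H x y yI xy | H y yI].
  by move/forallP/(_ x)/implyP: (H y yI); apply.
by apply/forallP=> x; apply/implyP; apply: H.
Qed.

Definition ideal_max I := [set x in I | [forall y in I, le x y ==> (y == x)]].

Lemma ideal_maxP I x :
  reflect (x \in I /\ forall y, y \in I -> le x y -> y = x) (x \in ideal_max I).
Proof.
rewrite inE; apply: (iffP andP) => [[xI /forall_inP H]|[xI H]]; split=> //.
  by move=> y yI xy; apply/eqP; move/implyP: (H y yI); apply.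
by apply/forall_inP=> y yI; apply/implyP=> xy; apply/eqP/H.
Qed.

Lemma ideal_max_sub I : ideal_max I \subset I.
Proof. by apply/subsetP=> x /ideal_maxP[]. Qed.

Lemma ideal_max_subset I J x :
  J \subset I -> x \in J -> x \in ideal_max I -> x \in ideal_max J.
Proof.
move=> /subsetP JI xJ /ideal_maxP[xI H]; apply/ideal_maxP; split=> // y yJ.
exact/H/JI.
Qed.

Lemma order_idealD1 I i :
  order_ideal le I -> i \in ideal_max I -> order_ideal le (I :\ i).
Proof.
move=> /order_idealP idI /ideal_maxP[iI H]; apply/order_idealP=> x y.
rewrite !inE => /andP[yi yI] xy; rewrite (idI x y) // andbT.
apply/eqP=> xi; move/eqP: yi; apply; apply: H => //; by rewrite -xi.
Qed.

Lemma le_ideal_max I x : x \in I -> exists2 y, y \in ideal_max I & le x y.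
Proof.
move=> xI; pose P y := (y \in I) && le x y.
have Px : P x by rewrite /P xI le_refl.
(* Among the elements of [I] above [x], one with the largest down-set is maximal, since a strictly
   greater element has a strictly larger down-set. *)
case: (arg_maxnP (fun y => #|[set z | le z y]|) Px) => y /andP[yI xy] ymax.
exists y => //; apply/ideal_maxP; split=> // z zI yz.
have /ymax : P z by rewrite /P zI (le_trans xy).
move=> /= zy; apply: contraTeq zy => nzy; rewrite -ltnNge.
apply: proper_card; apply/properP; split.
  by apply/subsetP=> w; rewrite !inE => /le_trans; apply.
exists z; rewrite !inE ?le_refl //.
by apply: contra nzy => zy; apply/eqP/le_anti; rewrite zy yz.
Qed.

Lemma sub_ideal_max I U :
  order_ideal le U -> (ideal_max I \subset U) = (I \subset U).
Proof.
move=> /order_idealP idU; apply/idP/idP; last exact: subset_trans (ideal_max_sub I).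
move=> /subsetP IU; apply/subsetP=> x /le_ideal_max[y /IU yU xy].
exact: idU xy.
Qed.

Definition covers i j :=
  [&& i != j, le i j & [forall z, le i z && le z j ==> (z == i) || (z == j)]].

(** Take a violating pair [i], [j] with the smallest interval. An element [z] strictly between them
    would give a violating pair with a smaller interval: ([i], [z]) if [z] is in [U], and ([z], [j])
    otherwise. *)
Lemma not_ideal_covers U : ~~ order_ideal le U ->
  exists i j, [/\ covers i j, j \in U & i \notin U].
Proof.
pose P (u : T * T) := [&& le u.1 u.2, u.2 \in U & u.1 \notin U].
move=> nU; have [u0 Pu0] : exists u, P u.
  apply/existsP; apply: contraNT nU => /existsPn nP.
  apply/order_idealP=> x y yU xy; have := nP (x, y).
  by rewrite /P /= xy yU /= negbK.
pose between (u : T * T) := [set z | le u.1 z && le z u.2].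
case: (arg_minnP (fun u => #|between u|) Pu0) => -[i j] /and3P[/= ij jU iU] umin.
exists i, j; split=> //; apply/and3P; split=> //.
  by apply: contraNneq iU => ->.
apply/forallP=> z; apply/implyP=> /andP[iz zj].
apply/norP=> -[zi zjn].
have [zU|zU] := boolP (z \in U).
- have /umin : P (i, z) by rewrite /P /= iz zU.
  rewrite leqNgt => /negP; apply; apply: proper_card; apply/properP; split.
    by apply/subsetP=> w; rewrite !inE /= => /andP[-> /le_trans]; apply.
  exists j; rewrite !inE /= ?ij ?le_refl //=.
  by apply: contra zjn => jz; apply/eqP/le_anti; rewrite zj.
have /umin : P (z, j) by rewrite /P /= zj jU.
rewrite leqNgt => /negP; apply; apply: proper_card; apply/properP; split.
  by apply/subsetP=> w; rewrite !inE /= => /andP[zw ->]; rewrite (le_trans iz).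
exists i; rewrite !inE /= ?ij ?le_refl //= andbT.
by apply: contra zi => jz; apply/eqP/le_anti; rewrite iz jz.
Qed.

End Ideals.

(** * Multiplicative Moebius inversion over a family of sets *)

Lemma mobius_prod (F : fieldType) (T : finType) (L : {set {set T}})
    (f : {set T} -> F) : (forall U, U \in L -> f U != 0) ->
  exists q : {set T} -> F,
    forall U, U \in L -> f U = \prod_(I in L | I \subset U) q I.
Proof.
move=> f0.
suff H n : exists q : {set T} -> F, forall U, U \in L -> (#|U| < n)%N ->
    f U = \prod_(I in L | I \subset U) q I.
  have [q Hq] := H #|T|.+1; exists q => U UL.
  by apply: Hq => //; rewrite ltnS max_card.
elim: n => [|n [q Hq]]; first by exists (fun=> 0).
(* The weights are built by increasing cardinality; at size [n] the weight of [U] is the quotient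
   that makes the formula for [f U] hold. *)
pose q' (U : {set T}) := if (#|U| < n)%N then q U
  else f U / \prod_(I in L | (I \subset U) && (I != U)) q I.
exists q' => U UL; rewrite ltnS leq_eqVlt => /orP[/eqP Un|Un]; last first.
  rewrite Hq //; apply: eq_bigr => I /andP[_ IU].
  by rewrite /q' (leq_ltn_trans (subset_leq_card IU) Un).
have sub_lt (I : {set T}) : I \subset U -> I != U -> (#|I| < n)%N.
  by move=> IU nIU; rewrite -Un proper_card // properEneq nIU.
rewrite (bigD1 U) /=; last by rewrite UL subxx.
rewrite (eq_bigl (fun I : {set T} => (I \in L) && ((I \subset U) && (I != U)))); last first.
  by move=> I; rewrite andbA.
have -> : q' U = f U / \prod_(I in L | (I \subset U) && (I != U)) q I.
  by rewrite /q' Un ltnn.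
rewrite [X in _ * X](eq_bigr q); last first.
  by move=> I /and3P[_ IU nIU]; rewrite /q' sub_lt.
(* The divisor is nonzero because each [q I] in it is a factor of [f I], which is nonzero. *)
rewrite divfK //; apply/prodf_neq0 => I /and3P[IL IU nIU].
have := f0 I IL; rewrite Hq ?sub_lt // (bigD1 I) /=; last by rewrite IL subxx.
by rewrite mulf_eq0 negb_or => /andP[].
Qed.

(** * Functions that factor over the maximal cliques *)

Section Factorable.
Variables (R : realType) (T : finType) (e : rel T).
Implicit Types (F G : {set T} -> R) (K U : {set T}).

Definition clique_product F : Prop := exists a : {set T} -> {set T} -> R,
  forall U, F U = \prod_(S | maximal_clique e S) a S (S :&: U).

Lemma clique_product_ext F G : F =1 G -> clique_product F -> clique_product G.
Proof. by move=> FG [a Fa]; exists a => U; rewrite -FG. Qed.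

Lemma clique_product1 : clique_product (fun=> 1).
Proof. by exists (fun _ _ => 1) => U; rewrite big1. Qed.

Lemma clique_productM F G :
  clique_product F -> clique_product G -> clique_product (fun U => F U * G U).
Proof.
move=> [a Fa] [b Gb]; exists (fun S V => a S V * b S V) => U.
by rewrite Fa Gb big_split.
Qed.

Lemma clique_product_prod (I : Type) (r : seq I) (P : pred I)
    (F : I -> {set T} -> R) : (forall i, P i -> clique_product (F i)) ->
  clique_product (fun U => \prod_(i <- r | P i) F i U).
Proof.
move=> HF; elim: r => [|i r IH].
  by apply: clique_product_ext clique_product1 => U; rewrite big_nil.
have [Pi|nPi] := boolP (P i).
  by apply: clique_product_ext (clique_productM (HF i Pi) IH) => U; rewrite big_cons Pi.
by apply: clique_product_ext IH => U; rewrite big_cons (negbTE nPi).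
Qed.

(** Extend [K] to a maximal clique [M] and give [M] the whole factor. It sees enough of [U], because
    [K] meets [U] and the intersection of [M] with [U] in the same set. *)
Lemma clique_product_clique K (g : {set T} -> R) :
  clique e K -> clique_product (fun U => g (K :&: U)).
Proof.
move=> clK; have [M maxM KM] := maxset_exists clK.
exists (fun S V => if S == M then g (K :&: V) else 1) => U.
rewrite (bigD1 M) //= eqxx big1 ?mulr1 ?setIA ?(setIidPl KM) //.
by move=> S /andP[_ /negbTE ->].
Qed.

End Factorable.

(** * Distributions supported on the order ideals *)

Section IdealSupport.
Variables (R : realType) (T : finType) (le e : rel T) (p : {set T} -> R).
Hypotheses (le_poset : is_poset le) (supp_p : supp p = ideal_lattice le).
Hypothesis markov_p : pairwise_markov e p.
Implicit Types (I J U : {set T}) (i j : T).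

Lemma ideal_lattice_gt0 U : (U \in ideal_lattice le) = (0 < p U).
Proof. by rewrite -supp_p inE. Qed.

Lemma covers_edge i j : (forall U, 0 <= p U) -> covers le i j -> e i j.
Proof.
move=> p_ge0 /and3P[ij leij /forallP cov]; have [le_refl le_anti le_trans] := le_poset.
apply: contraT => nij; pose U := [set z | le z j].
have idU : order_ideal le U.
  by apply/order_idealP=> x y; rewrite !inE => yj /le_trans; apply.
have jmax : j \in ideal_max le U.
  apply/ideal_maxP; split=> [|y]; first by rewrite inE le_refl.
  by rewrite inE => yj jy; apply: le_anti; rewrite yj.
(* Covering enters here: an element of [U] other than [j] that lies above [i] is between [i] and
   [j], hence equals [i]. *)
have imax : i \in ideal_max le (U :\ j).
  apply/ideal_maxP; split=> [|y]; first by rewrite !inE ij.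
  rewrite !inE => /andP[yj leyj] iy; have := cov y.
  by rewrite iy leyj (negbTE yj) orbF => /eqP.
have idUj := order_idealD1 idU jmax.
have idUij := order_idealD1 idUj imax.
have nidUi : ~~ order_ideal le (U :\ i).
  apply/negP=> /order_idealP/(_ i j); rewrite !inE eqxx le_refl eq_sym ij /=.
  by move=> /(_ isT leij).
have iU : i \in U by rewrite inE.
have jU : j \in U by rewrite inE.
have := pairwise_markov_mul markov_p ij nij iU jU.
have -> : p (U :\ i) = 0.
  apply/eqP; rewrite eq_le p_ge0 andbT leNgt -ideal_lattice_gt0 inE //.
have -> : U :\ i :\ j = U :\ j :\ i.
  by apply/setP=> x; rewrite !inE andbCA.
rewrite mul0r => /eqP; rewrite gt_eqF // mulr_gt0 // -ideal_lattice_gt0 inE //.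
Qed.

(** Let [i] and [j] be nonadjacent maximal elements of [I]. The Markov relation at [I] says that the
    weights of the ideals inside [I] containing both have product 1. In each such ideal [i] and [j]
    are still maximal, so by induction on size the proper ones have weight 1, and only [q I]
    remains. *)
Lemma mobius_prod_eq1 (q : {set T} -> R) I :
    (forall U, U \in ideal_lattice le ->
      p U = \prod_(J in ideal_lattice le | J \subset U) q J) ->
    I \in ideal_lattice le -> ~~ clique e (ideal_max le I) -> q I = 1.
Proof.
move=> pq; have q_eq1 i j : i != j -> ~~ e i j -> forall n I, (#|I| < n)%N ->
    I \in ideal_lattice le -> i \in ideal_max le I -> j \in ideal_max le I -> q I = 1.
  move=> ij nij; elim=> [//|n IHn] {}I; rewrite ltnS => In IL imax jmax.
  have idI : order_ideal le I by rewrite inE in IL.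
  have iI := subsetP (ideal_max_sub le I) i imax.
  have jI := subsetP (ideal_max_sub le I) j jmax.
  have IiL : I :\ i \in ideal_lattice le by rewrite inE order_idealD1.
  have IjL : I :\ j \in ideal_lattice le by rewrite inE order_idealD1.
  have IijL : I :\ i :\ j \in ideal_lattice le.
    rewrite inE order_idealD1 ?order_idealD1 //.
    by apply: ideal_max_subset jmax; rewrite ?subsetDl // !inE eq_sym ij.
  (* The ideals inside [I] are sorted by whether they contain [i] and [j]; the four probabilities
     are products of these blocks. *)
  pose Q (b c : bool) := \prod_(J in ideal_lattice le |
    [&& J \subset I, (i \in J) == b & (j \in J) == c]) q J.
  have pI : p I = Q true true * Q true false * (Q false true * Q false false).
    rewrite pq // (bigID (fun J : {set T} => i \in J)) /=; congr (_ * _).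
      rewrite (bigID (fun J : {set T} => j \in J)) /=.
      by congr (_ * _); apply: eq_bigl => J; rewrite ?eqb_id ?eqbF_neg -!andbA.
    rewrite (bigID (fun J : {set T} => j \in J)) /=.
    by congr (_ * _); apply: eq_bigl => J; rewrite ?eqb_id ?eqbF_neg -!andbA.
  have pIi : p (I :\ i) = Q false true * Q false false.
    rewrite pq // (bigID (fun J : {set T} => j \in J)) /=.
    by congr (_ * _); apply: eq_bigl => J;
      rewrite subsetD1 ?eqb_id ?eqbF_neg -!andbA.
  have pIj : p (I :\ j) = Q true false * Q false false.
    rewrite pq // (bigID (fun J : {set T} => i \in J)) /=.
    by congr (_ * _); apply: eq_bigl => J;
      rewrite subsetD1 ?eqb_id ?eqbF_neg -!andbA [(j \notin J) && _]andbC.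
  have pIij : p (I :\ i :\ j) = Q false false.
    by rewrite pq //; apply: eq_bigl => J; rewrite !subsetD1 !eqbF_neg -!andbA.
  have Q1 : Q true true = 1.
    have := pairwise_markov_mul markov_p ij nij iI jI.
    have : p (I :\ i) * p (I :\ j) != 0.
      by rewrite mulf_neq0 // gt_eqF // -ideal_lattice_gt0.
    (* The Markov relation is now [Q true true] times a nonzero quantity equal to that same
       quantity. *)
    rewrite pI pIi pIj pIij => nz E.
    by apply: (mulIf nz); rewrite mul1r -[RHS]E; ring.
  move: Q1; rewrite /Q (bigD1 I) /=; last by rewrite IL subxx iI jI.
  rewrite big1 ?mulr1 // => J /andP[/andP[JL /and3P[JI /eqP iJ /eqP jJ]] nJI].
  apply: IHn => //; last 2 first.
  - exact: ideal_max_subset imax.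
  - exact: ideal_max_subset jmax.
  by apply: leq_trans In; rewrite proper_card // properEneq nJI.
move=> IL; rewrite /clique => /forall_inPn[i imax /forall_inPn[j jmax]].
rewrite negb_imply => /andP[ij nij].
exact: (q_eq1 i j ij nij #|I|.+1).
Qed.

Lemma factors_ideal_support :
  simple_graph e -> (forall U, 0 <= p U) -> factors_according_to e p.
Proof.
move=> [e_sym _] p_ge0.
have [q pq] : exists q : {set T} -> R, forall U, U \in ideal_lattice le ->
    p U = \prod_(J in ideal_lattice le | J \subset U) q J.
  by apply: mobius_prod => U; rewrite ideal_lattice_gt0 => /gt_eqF ->.
pose K I := ideal_max le I.
(* The test [K I \subset U] is written with [K I :&: U] to show that the factor depends on [U] only
   inside the clique [K I]. *)
pose F U := \prod_(I in ideal_lattice le | clique e (K I))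
  (if K I \subset K I :&: U then q I else 1).
(* A factor vanishes exactly when [U] contains the upper element of a covering pair without the
   lower one, so [G] is the indicator of the ideals. *)
pose G U := \prod_(u : T * T | covers le u.1 u.2)
  (if [set u.1; u.2] :&: U == [set u.2] then 0 else 1 : R).
suff pFG U : p U = F U * G U.
  suff [a FGa] : clique_product e (fun U => F U * G U).
    exists a, 1; split=> [|U]; first exact: oner_neq0.
    by rewrite invr1 mul1r pFG.
  apply: clique_productM; apply: clique_product_prod.
    move=> I /andP[_ clI].
    exact: (clique_product_clique (fun V => if K I \subset V then q I else 1)).
  move=> [i j] /= cov.
  apply: (clique_product_clique (fun V => if V == [set j] then 0 else 1)).
  have eij := covers_edge p_ge0 cov.
  rewrite /clique; apply/forall_inP=> x xij; apply/forall_inP=> y yij; apply/implyP.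
  by case/set2P: xij => ->; case/set2P: yij => -> //; rewrite ?eqxx // e_sym.
have [UL|nUL] := boolP (U \in ideal_lattice le); last first.
  have /eqP -> : p U == 0 by rewrite eq_le p_ge0 andbT leNgt -ideal_lattice_gt0.
  have [|i [j [cov jU iU]]] := @not_ideal_covers T le le_poset U.
    by move: nUL; rewrite inE.
  rewrite /G (bigD1 (i, j)) //= (_ : _ :&: U == _) ?mul0r ?mulr0 //.
  apply/eqP/setP=> x; rewrite !inE.
  case: (eqVneq x j) => [->|] /=; first by rewrite orbT jU.
  by rewrite orbF; case: (eqVneq x i) => [->|] //=; rewrite (negbTE iU).
have idU : order_ideal le U by rewrite inE in UL.
have -> : G U = 1.
  rewrite /G big1 // => -[i j] /= /and3P[nij ij _]; case: ifP => // /eqP/setP ijU.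
  have := ijU j; rewrite !inE eqxx orbT /= => jU.
  have iU := order_idealP _ _ idU i j jU ij.
  by have := ijU i; rewrite !inE eqxx /= iU (negbTE nij).
(* On an ideal [U], the inversion formula loses its non-clique weights, all equal to 1, and
   [I \subset U] becomes [K I \subset U]. *)
rewrite mulr1 pq // /F -big_mkcondr /= [LHS](bigID (fun I => clique e (K I))) /=.
rewrite [X in _ * X]big1 ?mulr1; last first.
  by move=> I /andP[/andP[IL _] nI]; apply: mobius_prod_eq1 nI.
apply: eq_bigl => I; rewrite subsetI subxx /= sub_ideal_max // -!andbA.
by congr (_ && _); rewrite andbC.
Qed.

End IdealSupport.

Theorem theorem6p1 (R : realType) (m : nat) (hm : (0 < m)%N)
    (le : rel 'I_m) (hP : is_poset le)
    (L : {set {set 'I_m}}) (hL : natural_lattice L)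
    (hLP : L = ideal_lattice le)
    (e : rel 'I_m) (hG : simple_graph e)
    (p : {set 'I_m} -> R) (hp : distribution p) (hsupp : supp p = L)
    (hmarkov : pairwise_markov e p) :
  factors_according_to e p.
Proof.
case: hp => p_ge0 _; rewrite hLP in hsupp.
exact: (factors_ideal_support hP hsupp hmarkov hG p_ge0).
Qed.
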